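(* Let $G$ be a graph with $\Delta(G)\in\{2,3,4,5\}$. If $\chi'(G)\ge\Delta(G)+1$, then $\Gamma(G)\ge\Delta(G)$.
   Context: All graphs are finite, undirected, loopless, and may contain parallel edges. $\Delta(G)$ is the maximum degree (parallel edges counted separately). The chromatic index $\chi'(G)$ is the least $k$ such that $E(G)$ can be partitioned into $k$ matchings. The density of $G$ is $$\Gamma(G)=\max_{H\subseteq G,\ |H|\ge 2}\left\lceil\frac{|E(H)|}{\lfloor |H|/2\rfloor}\right\rceil,$$ where the maximum is over subgraphs $H$ of $G$ with $|H|=|V(H)|\ge 2$ vertices. *)

(* Defs.v *)
From mathcomp Require Import all_boot.

Set Implicit Arguments.
Unset Strict Implicit.
Unset Printing Implicit Defensive.

(* Edges are abstract, so distinct edges may have the same ends (parallel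
   edges); having exactly two ends excludes loops. *)
Record multigraph := Multigraph {
  vertex : finType;
  edge : finType;
  ends : edge -> {set vertex};
  card_ends : forall e : edge, #|ends e| = 2
}.

Definition degree (G : multigraph) (v : vertex G) : nat :=
  #|[set e : edge G | v \in ends e]|.

Definition max_degree (G : multigraph) : nat :=
  \max_(v : vertex G) degree v.

Definition matching (G : multigraph) (M : {set edge G}) : bool :=
  [forall e in M, forall f in M, (e != f) ==> [disjoint ends e & ends f]].

Definition matching_partition (G : multigraph) (k : nat) : bool :=
  [exists P : {set {set edge G}},
    [&& partition P [set: edge G], #|P| == k & [forall M in P, matching M]]].

Lemma ex_matching_partition (G : multigraph) :
  exists k, matching_partition G k.
Proof.
pose P := [set [set e] | e : edge G].
exists #|P|; apply/existsP; exists P; rewrite eqxx /=; apply/andP; split.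
  apply/and3P; split.
  - rewrite eqEsubset subsetT /=; apply/subsetP=> e _.
    by apply/bigcupP; exists [set e]; rewrite ?set11 ?imset_f.
  - apply/trivIsetP=> _ _ /imsetP[e _ ->] /imsetP[f _ ->] neq_ef.
    by rewrite disjoints1 inE; apply: contraNneq neq_ef => ->.
  - by apply/imsetP=> -[e _ /setP/(_ e)]; rewrite !inE eqxx.
apply/forall_inP=> _ /imsetP[e _ ->].
by do 2!apply/forall_inP=> ? /set1P->; rewrite eqxx.
Qed.

Definition chromatic_index (G : multigraph) : nat :=
  ex_minn (ex_matching_partition G).

Definition ceil_div (m d : nat) : nat := (m + d.-1) %/ d.

Lemma ceil_div_le (m d k : nat) : 0 < d -> (ceil_div m d <= k) = (m <= k * d).
Proof.
case: d => // d _.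
by rewrite /ceil_div -ltnS ltn_divLR // mulSn addnC /= addSn ltnS leq_add2l.
Qed.

(* A subgraph is a pair (vertex set, edge set). *)
Definition subgraph (G : multigraph) (H : {set vertex G} * {set edge G}) :
  bool := [forall e in H.2, ends e \subset H.1].

Definition density (G : multigraph) : nat :=
  \max_(H : {set vertex G} * {set edge G} | subgraph H && (2 <= #|H.1|))
    ceil_div #|H.2| #|H.1|./2.

(* Main.v *)
Require Import Defs.
From mathcomp Require Import all_boot perm.
From mathcomp Require Import zify.

Set Implicit Arguments.
Unset Strict Implicit.
Unset Printing Implicit Defensive.

(** Let k be the maximum degree and suppose that the graph is not k-edge-colorable.
    An inclusion-minimal set of edges that is not k-colorable gives a critical
    graph: for every edge e there is a proper k-coloring of all edges but e.  It is
    enough to find in it a vertex set A spanning more than (k - 1) * floor(|A| / 2)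
    edges ([critical_dense]).

    Write d(v) = k - deg(v) for the deficit of v.  Since a coloring leaves d(v) or
    d(v) + 1 colors free at v, Kempe chains turn into inequalities on deficits.
    Three are used.  Adjacent vertices satisfy d(x) + d(y) + 2 <= k
    ([deficit_edge]).  If xy is an edge, then x has more than d(y) edges to vertices
    z other than y with d(x) + d(y) + d(z) + 2 <= k ([adjacency], in the style of
    the adjacency lemma of Vizing).  If d(x) + d(y) + 2 = k, then all vertices at
    the end of a path x y w v have deficit at most 1 ([distance_two]).

    These drive a discharging argument with charge 1 - d(v) on the non-isolated
    vertices.  Only the full vertices (d = 0) have positive charge, namely 1, and
    only the low ones (d >= 2) have negative charge.  Every low vertex y sends the
    demand d(y) - 1 along each of its edges to full vertices; there are at least two
    of them ([low_full]), while a full vertex sees a total demand of at most 2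
    because k <= 5 ([pay_le]).  So the total charge is at least 0.  If it is
    positive, the average degree exceeds k - 1 and the set of all non-isolated
    vertices is dense.  If it is 0, all these inequalities are equalities.  Then
    k = 5 and three vertices span at least 5 edges: around a low vertex by
    [distance_two] ([low_dense]), and if all vertices have deficit 1 by a further
    Kempe chain argument ([triangle]). *)

(** * Partial edge colorings and Kempe chains *)

Section Colorings.

Variables (G : multigraph) (k : nat).
Local Notation C := 'I_k.
Implicit Types (c : edge G -> option C) (e f g : edge G) (u v w x y z : vertex G).
Implicit Types a b d : C.

Lemma ends_neq e x y : ends e = [set x; y] -> x != y.
Proof. by move=> E; move: (card_ends e); rewrite E cards2; case: eqP. Qed.

Lemma ends_other e x : x \in ends e -> exists y, ends e = [set x; y].
Proof.
move=> xe; have /cards2P[u [v [_ E]]] : #|ends e| == 2 by rewrite card_ends.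
move: xe; rewrite E => /set2P[->|->]; first by exists v.
by exists u; rewrite setUC.
Qed.

Lemma ends_inj e x y z : ends e = [set x; y] -> ends e = [set x; z] -> y = z.
Proof.
move=> E E'; have := ends_neq E.
have: y \in ends e by rewrite E set22.
by rewrite E' => /set2P[->|//]; rewrite eqxx.
Qed.

Definition proper c :=
  forall e f v d, v \in ends e -> v \in ends f ->
    c e = Some d -> c f = Some d -> e = f.

Definition miss c v : {set C} :=
  [set d | [forall e, (v \in ends e) ==> (c e != Some d)]].

Lemma missP c v d :
  reflect (forall e, v \in ends e -> c e <> Some d) (d \in miss c v).
Proof.
rewrite inE; apply: (iffP forallP) => H e; first by move/(implyP (H e))/eqP.
by apply/implyP=> /H/eqP.
Qed.

Lemma missPn c v d : d \notin miss c v -> exists2 e, v \in ends e & c e = Some d.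
Proof.
by rewrite inE => /forallPn[e]; rewrite negb_imply negbK => /andP[ve /eqP]; exists e.
Qed.

(** Kempe chains are handled through their vertex sets, the connected components
    of this relation. *)
Definition chain c a b : rel (vertex G) := fun u v =>
  [exists e, (ends e == [set u; v]) && ((c e == Some a) || (c e == Some b))].

Lemma chainP c a b u v :
  reflect (exists2 e, ends e = [set u; v] & c e = Some a \/ c e = Some b)
          (chain c a b u v).
Proof.
apply: (iffP existsP) => [[e /andP[/eqP E /orP K]]|[e E K]]; exists e => //.
  by case: K => /eqP; [left|right].
by rewrite E eqxx; case: K => ->; rewrite eqxx ?orbT.
Qed.

Lemma chain_sym c a b : symmetric (chain c a b).
Proof. by move=> u v; rewrite /chain; under eq_existsb => e do rewrite setUC. Qed.

Lemma chain_conn_sym c a b : connect_sym (chain c a b).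
Proof. exact/sym_connect_sym/chain_sym. Qed.

Definition kempe c a b v := fun e =>
  if [exists u in ends e, connect (chain c a b) v u] then omap (tperm a b) (c e)
  else c e.

(** Any end of e may be used to decide whether e is recolored: an edge colored a or
    b has both ends in the same component, and the transposition fixes the other
    colors. *)
Lemma kempeE c a b v e u : u \in ends e ->
  kempe c a b v e =
    if connect (chain c a b) v u then omap (tperm a b) (c e) else c e.
Proof.
move=> ue; rewrite /kempe; case: ifPn => [|/exists_inPn /(_ u ue) /negPf -> //].
case: ifPn => // vu /exists_inP[w we vw].
have [E|] := eqVneq u w; first by rewrite E vw in vu.
have [w' E] := ends_other ue; move: (we); rewrite E => /set2P[-> /eqP//|ww' _].
rewrite -ww' in E; case ce: (c e) => [d|] //=.
case: tpermP => // K; case/negP: vu; apply: connect_trans vw (connect1 _);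
  by rewrite chain_sym; apply/chainP; exists e => //; rewrite ce K;
  (by left) || (by right).
Qed.

Lemma kempe_proper c a b v : proper c -> proper (kempe c a b v).
Proof.
move=> pc e f u d ue uf; rewrite !(kempeE _ _ _ _ ue, kempeE _ _ _ _ uf).
case: ifP => _; last exact: pc ue uf.
case ce: (c e) => [d1|] //= [<-]; case cf: (c f) => [d2|] //= [/perm_inj E].
by apply: (pc e f u d1); rewrite // cf E.
Qed.

Lemma kempe_None c a b v e : (kempe c a b v e == None) = (c e == None).
Proof. by rewrite /kempe; case: ifP => // _; case: (c e). Qed.

Lemma kempe_miss c a b v u d :
  (d \in miss (kempe c a b v) u) =
  ((if connect (chain c a b) v u then tperm a b d else d) \in miss c u).
Proof.
apply/missP/missP => H e ue; move: (H e ue); rewrite (kempeE _ _ _ _ ue);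
  case: ifP => // _; case: (c e) => [d'|] //= K [E]; case: K; congr Some.
- by rewrite E tpermK.
- by rewrite -E tpermK.
Qed.

Definition chain_end c a b u := (a \in miss c u) || (b \in miss c u).

Lemma chain_end_nbr c a b u v w : proper c -> chain_end c a b u ->
  chain c a b u v -> chain c a b u w -> v = w.
Proof.
move=> pc U /chainP[e E ce] /chainP[f F cf].
have ue : u \in ends e by rewrite E set21.
have uf : u \in ends f by rewrite F set21.
suff ef : e = f by rewrite -ef in F; apply: ends_inj E F.
case/orP: U => /missP U; [have U1 := U e ue | have U1 := U e ue];
  have U2 := U f uf; case: ce => // ce; case: cf => // cf;
  exact: pc ue uf ce cf.
Qed.

Lemma chain_mid_nbr c a b u v w z : proper c -> v != w ->
  chain c a b u v -> chain c a b u w -> chain c a b u z -> z = v \/ z = w.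
Proof.
move=> pc vw /chainP[e E ce] /chainP[f F cf] /chainP[g Hg cg].
have ue : u \in ends e by rewrite E set21.
have uf : u \in ends f by rewrite F set21.
have ug : u \in ends g by rewrite Hg set21.
have ef : e <> f.
  by move=> K; rewrite -K in F; case/eqP: vw; apply: ends_inj E F.
have [K|K] : g = e \/ g = f.
- case: ce => ce; case: cf => cf; case: cg => cg;
    try (by left; exact: pc ug ue cg ce); try (by right; exact: pc ug uf cg cf);
    by case: ef; exact: pc ue uf ce cf.
- by rewrite K in Hg; left; apply: ends_inj Hg E.
- by rewrite K in Hg; right; apply: ends_inj Hg F.
Qed.

Lemma path_mid (r : rel (vertex G)) u p z : symmetric r ->
  path r u p -> uniq (u :: p) -> z \in p ->
  exists2 s, s \in u :: p /\ r z s &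
    z = last u p \/ exists2 t, t \in u :: p /\ r z t & s != t.
Proof.
move=> rsym up Up zp; case/splitPr: zp up Up => p1 p2.
rewrite cat_path /= => /and3P[_ r1 p2p] Up.
exists (last u p1).
  by rewrite -cat_cons mem_cat mem_last rsym.
case: p2 p2p Up => [|t p2] /=; first by left; rewrite last_cat.
case/andP=> zt _ Up; right; exists t.
  by rewrite inE mem_cat !inE eqxx !orbT.
have: uniq ((u :: p1) ++ [:: z, t & p2]) by [].
rewrite cat_uniq => /and3P[_ /hasPn H _].
apply: contraTneq (mem_last u p1) => ->; apply: H.
by rewrite !inE eqxx orbT.
Qed.

(** A component of the subgraph formed by two colors is a path or a cycle, so at
    most two of its vertices miss one of the two colors.  A simple path from u to v
    is closed under adjacency, because its inner vertices already have both their
    neighbors on it; hence w would be an inner vertex, which misses no color. *)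
Lemma chain_two_ends c a b u v w : proper c -> chain_end c a b u -> chain_end c a b v ->
  chain_end c a b w -> u != v -> u != w -> v != w ->
  connect (chain c a b) u v -> connect (chain c a b) u w -> False.
Proof.
move=> pc U V W uv uw vw /connectP[p0 p0p vE] /connectP[q qp wE].
case/shortenP: p0p vE => p up Up _ vE.
have sym := chain_sym c a b.
have closed z z' : z \in u :: p -> chain c a b z z' -> z' \in u :: p.
  rewrite inE => /predU1P[->|zp] zz'.
    case: p vE up {Up} => [/eqP|s p _ /= /andP[us _]].
      by rewrite eq_sym (negPf uv).
    by rewrite (chain_end_nbr pc U zz' us) !inE eqxx orbT.
  have [s [sp zs] [zv|[t [tp zt] st]]] := path_mid sym up Up zp.
    by rewrite (chain_end_nbr pc _ zz' zs) // zv -vE.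
  by have [->|->] := chain_mid_nbr pc st zs zt zz'.
have {q qp wE} wp : w \in u :: p.
  have reach r z : z \in u :: p -> path (chain c a b) z r -> last z r \in u :: p.
    elim: r z => //= s r IH z zp /andP[zs]; exact/IH/(closed z).
  by rewrite wE; apply: reach; rewrite ?mem_head.
rewrite inE eq_sym (negPf uw) /= in wp.
have [s [sp ws] [wv|[t [tp wt] st]]] := path_mid sym up Up wp.
  by rewrite vE wv eqxx in vw.
by rewrite (chain_end_nbr pc W ws wt) eqxx in st.
Qed.

(** * Colorings of all edges but one *)

Definition all_but e0 c := proper c /\ forall f, (c f == None) = (f == e0).

Hypothesis uncolorable : forall c, proper c -> exists e, c e = None.

Lemma kempe_all_but e0 c a b v : all_but e0 c -> all_but e0 (kempe c a b v).
Proof.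
by case=> pc nc; split=> [|f]; [exact: kempe_proper | rewrite kempe_None].
Qed.

Lemma uncolored_disj e0 c x y d : all_but e0 c -> ends e0 = [set x; y] ->
  d \in miss c x -> d \in miss c y -> False.
Proof.
move=> [pc nc] E /missP dx /missP dy.
have dfree f v : v \in ends e0 -> v \in ends f -> c f <> Some d.
  by rewrite E => /set2P[->|->]; [exact: dx | exact: dy].
pose c' f := if f == e0 then Some d else c f.
have pc' : proper c'.
  move=> e f v d' ve vf; rewrite /c'.
  case: eqP => [ee|_]; case: eqP => [fe|_]; first by rewrite ee fe.
  - by move=> [<-] cf; case: (dfree f v); rewrite -?ee.
  - by move=> ce [dd]; case: (dfree e v); rewrite -?fe // dd.
  - exact: pc ve vf.
have [e] := uncolorable pc'; rewrite /c'; case: eqP => // /eqP/negPf ee0 /eqP.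
by rewrite nc ee0.
Qed.

(** Otherwise exchanging a and b on the component of y frees a at both ends of the
    uncolored edge. *)
Lemma uncolored_link e0 c x y a b : all_but e0 c -> ends e0 = [set x; y] ->
  a \in miss c x -> b \in miss c y -> connect (chain c a b) x y.
Proof.
move=> nc E ax byy; apply/idPn => xy.
apply: (uncolored_disj (kempe_all_but a b y nc) E (d := a)).
  by rewrite kempe_miss chain_conn_sym (negPf xy).
by rewrite kempe_miss connect0 tpermL.
Qed.

(** Moves the uncolored place from e0 to f, e0 taking over the color of f. *)
Definition shift c e0 f := fun e =>
  if e == f then None else if e == e0 then c f else c e.

Lemma shift_all_but e0 f c x y z b : all_but e0 c ->
  ends e0 = [set x; y] -> ends f = [set x; z] -> c f = Some b ->
  b \in miss c y -> all_but f (shift c e0 f).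
Proof.
move=> [pc nc] E F cf /missP byy.
have fe0 : f != e0 by rewrite -nc cf.
have sub e v : e != f -> v \in ends e0 -> v \in ends e -> c e <> Some b.
  move=> ef; rewrite E => /set2P[->|->]; last exact: byy.
  move=> xe ce; case/eqP: ef; apply: (pc e f x b) => //.
  by rewrite F set21.
split=> [e g v d ve vg|g]; rewrite /shift; last first.
  have [//|gf] := eqVneq g f; have [_|ge] := eqVneq g e0; first by rewrite cf.
  by rewrite nc (negPf ge).
have [//|ef] := eqVneq e f; have [//|gf] := eqVneq g f.
have [ee|ee] := eqVneq e e0; have [ge|ge] := eqVneq g e0.
- by rewrite ee ge.
- by rewrite cf => -[<-] cg; case: (sub g v); rewrite -?ee.
- by rewrite cf => ce [bd]; case: (sub e v); rewrite -?ge // bd.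
- exact: pc ve vg.
Qed.

Lemma shift_miss e0 f c u b d : c f = Some b ->
  d \in miss c u -> (d = b -> u \notin ends e0) -> d \in miss (shift c e0 f) u.
Proof.
move=> cf /missP du db; apply/missP => e ue; rewrite /shift.
case: eqP => // _; case: eqP => [ee|_]; last exact: du.
by rewrite cf => -[/esym/db]; rewrite -ee ue.
Qed.

(** In this section e0 = xy is uncolored and the color b of f = xz is free at y:
    a two-edge fan at x. *)
Section Fan.

Variables (e0 f : edge G) (x y z : vertex G) (b : C).
Hypotheses (E : ends e0 = [set x; y]) (F : ends f = [set x; z]).

(** Shifting the uncolored place to xz keeps d free at both its ends. *)
Lemma fan_disj c d : all_but e0 c -> c f = Some b -> b \in miss c y ->
  d \in miss c x -> d \in miss c z -> False.
Proof.
move=> nc cf byy dx dz.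
have bf v : v \in ends f -> d \in miss c v -> d <> b.
  by move=> vf /missP/(_ f vf) + db; rewrite cf db.
have db : d <> b by apply: bf dx; rewrite F set21.
by apply: (uncolored_disj (shift_all_but nc E F cf byy) F (d := d));
  apply: shift_miss cf _ _ => //.
Qed.

(** Otherwise exchanging a and d on the component of z frees a at both x and z,
    without touching the color b of f. *)
Lemma fan_link c a d : all_but e0 c -> c f = Some b -> b \in miss c y ->
  a \in miss c x -> d \in miss c z -> connect (chain c a d) x z.
Proof.
move=> nc cf byy ax dz; apply/idPn => xz.
have bf v d' : v \in ends f -> d' \in miss c v -> d' != b.
  by move=> vf /missP/(_ f vf); rewrite cf => K; apply: contra_not_neq K => ->.
have ab : a != b by apply: bf ax; rewrite F set21.
have db : d != b by apply: bf dz; rewrite F set22.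
apply: (fan_disj (c := kempe c a d z) (d := a)) => //.
- exact: kempe_all_but.
- by rewrite (kempeE _ _ _ _ (_ : x \in _)) ?F ?set21 // chain_conn_sym (negPf xz).
- by rewrite kempe_miss; case: ifP => // _; rewrite tpermD.
- by rewrite kempe_miss chain_conn_sym (negPf xz).
- by rewrite kempe_miss connect0 tpermL.
Qed.

(** If d were free at y and z, the vertices x, y, z would be three ends of one chain
    in the colors a and d. *)
Lemma fan_disj_tip c a d : all_but e0 c -> c f = Some b -> b \in miss c y ->
  a \in miss c x -> d \in miss c y -> d \in miss c z -> False.
Proof.
move=> nc cf byy ax dy dz.
have yz : y != z.
  apply: contraTneq byy => ->; apply/negP => /missP/(_ f).
  by rewrite F set22 => /(_ isT).
apply: (@chain_two_ends c a d x y z); rewrite /chain_end ?ax ?dy ?dz ?orbT //.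
- by case: nc.
- exact: ends_neq E.
- exact: ends_neq F.
- exact: uncolored_link nc E ax dy.
- exact: fan_link.
Qed.

End Fan.

(** * Paths with three edges starting at the uncolored edge *)

(** Here e0 = xy is uncolored, and f = yw and g = wv continue it to a path; p and q
    denote the colors of f and g. *)
Section Kierstead.

Variables (e0 f g : edge G) (x y w v : vertex G).
Hypotheses (E : ends e0 = [set x; y]) (F : ends f = [set y; w]).
Hypotheses (Fg : ends g = [set w; v]).
Hypotheses (xw : x != w) (xv : x != v) (yv : y != v).

(** After shifting the uncolored place from xy to yw, the edge wv continues a fan at
    w, whose center and whose tip v both miss p. *)
Lemma kierstead_shift c p q : all_but e0 c -> c f = Some p -> c g = Some q ->
  p \in miss c x -> q \in miss c y -> p \in miss c v -> False.
Proof.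
move=> nc cf cg px qy pv; have [pc _] := nc.
have E' : ends e0 = [set y; x] by rewrite setUC.
have F' : ends f = [set w; y] by rewrite setUC.
have fe0 : f != e0 by case: nc => _ <-; rewrite cf.
have yw := ends_neq F.
have we0 : w \notin ends e0 by rewrite E !inE eq_sym negb_or xw eq_sym yw.
have wf : w \in ends f by rewrite F set22.
have wg : w \in ends g by rewrite Fg set21.
have qp : q <> p.
  by move=> qp; move/missP: qy => /(_ f); rewrite F set21 cf qp => /(_ isT).
have gf : g != f by apply: contra_not_neq qp => gf; move: cg; rewrite gf cf => -[].
have ge0 : g != e0 by case: nc => _ <-; rewrite cg.
apply: (fan_disj (b := q) (d := p) F' Fg (shift_all_but nc E' F cf px)).
- by rewrite /shift (negPf gf) (negPf ge0).
- by apply: shift_miss cf qy _ => /qp.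
- apply/missP => e we; rewrite /shift; case: (eqVneq e f) => // ef.
  case: eqP => [ee|_]; first by rewrite -ee we in we0.
  by move=> ce; rewrite (pc e f w p) ?eqxx in ef.
- apply: shift_miss cf pv _ => _; rewrite E !inE negb_or.
  by rewrite !(eq_sym v) xv yv.
Qed.

(** The sets X and Y of colors free at x and at y are assumed complementary.  Then a
    color r free at v can be exchanged for any color t of the other set without
    changing X and Y: the chain of x and y in these two colors joins x to y, so by
    [chain_two_ends] it avoids v.  The edge f is not affected, as it meets y. *)
Section Toggling.

Variables X Y : {set C}.
Hypotheses (XY : forall d, (d \in Y) = (d \notin X)).

Definition kstate c p q :=
  [/\ all_but e0 c, miss c x = X, miss c y = Y, c f = Some p & c g = Some q].

Lemma toggle c p q r t : kstate c p q -> r \in X -> t \in Y -> chain_end c r t v ->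
  exists2 c', kstate c' p (tperm r t q) &
    forall d, (d \in miss c' v) = (tperm r t d \in miss c v).
Proof.
move=> [nc cX cY cf cg] rX tY V; have [pc _] := nc.
have Ex : chain_end c r t x by rewrite /chain_end cX rX.
have Ey : chain_end c r t y by rewrite /chain_end cY tY orbT.
have xy : connect (chain c r t) x y by apply: uncolored_link E _ _; rewrite ?cX ?cY.
have nvx : connect (chain c r t) v x = false.
  apply/negP; rewrite chain_conn_sym => vx.
  exact: chain_two_ends pc Ex Ey V (ends_neq E) xv yv xy vx.
have nvy : connect (chain c r t) v y = false.
  apply: contraFF nvx => vy; apply: connect_trans vy _.
  by rewrite chain_conn_sym.
exists (kempe c r t v) => [|d]; last by rewrite kempe_miss connect0.
split; first exact: kempe_all_but.
- by apply/setP => d; rewrite kempe_miss nvx cX.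
- by apply/setP => d; rewrite kempe_miss nvy cY.
- by rewrite (kempeE _ _ _ _ (_ : y \in _)) ?F ?set21 // nvy.
- by rewrite (kempeE _ _ _ _ (_ : v \in _)) ?Fg ?set22 // connect0 cg.
Qed.

Lemma kstate_neq c p q : kstate c p q ->
  [/\ p \in X, p != q & forall d, d \in miss c v -> d != q].
Proof.
move=> [[pc _] cX cY cf cg]; split.
- rewrite -[p \in X]negbK -XY -cY; apply/negP => /missP/(_ f).
  by rewrite F set21 => /(_ isT).
- apply: contraNneq yv => pq; have fg : f = g.
    by apply: (pc f g w p); rewrite ?F ?Fg ?set21 ?set22 // pq.
  have: y \in ends f by rewrite F set21.
  by rewrite fg Fg => /set2P[yw|->//]; move: (ends_neq F); rewrite yw eqxx.
- move=> d /missP/(_ g); rewrite Fg set22 cg => /(_ isT) dq.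
  by apply: contra_not_neq dq => ->.
Qed.

Lemma XYneq d d' : d \in X -> d' \in Y -> d != d'.
Proof. by rewrite XY => dX; apply: contraNneq => <-. Qed.

(** The lemmas up to [far_end_misses_one] reduce every situation to this one, where
    [kierstead_shift] applies. *)
Lemma shiftable_absurd c p q : kstate c p q -> q \in Y -> p \in miss c v -> False.
Proof.
move=> st qY pv; have [pX _ _] := kstate_neq st.
case: st => nc cX cY cf cg.
by apply: (kierstead_shift nc cf cg); rewrite ?cX ?cY.
Qed.

(** Exchanging q and t at v gives g the color t of Y and keeps p free at v. *)
Lemma misses_p_and_Y_absurd c p q t : kstate c p q -> q \in X ->
  p \in miss c v -> t \in Y -> t \in miss c v -> False.
Proof.
move=> st qX pv tY tv; have [pX pq _] := kstate_neq st.
have [|c' st' mv] := toggle st qX tY; first by rewrite /chain_end tv orbT.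
rewrite tpermL in st'; apply: (shiftable_absurd st' tY).
by rewrite mv tpermD // eq_sym // XYneq.
Qed.

(** If s is not p itself, r is exchanged for p.  Then s is free at v as well, and it
    is in Y or can be exchanged for r. *)
Lemma misses_Y_absurd c p q r s : kstate c p q -> q \in X ->
  r \in Y -> r \in miss c v -> s \in miss c v -> s != r -> False.
Proof.
move=> st qX rY rv sv sr; have [pX pq vq] := kstate_neq st.
have [sp|sp] := eqVneq s p; first by
  apply: (misses_p_and_Y_absurd st qX _ rY); rewrite -?sp.
have [|c' st' mv] := toggle st pX rY; first by rewrite /chain_end rv orbT.
have qr := XYneq qX rY; rewrite (tpermD pq) 1?eq_sym // in st'.
have pv : p \in miss c' v by rewrite mv tpermL.
have sv' : s \in miss c' v by rewrite mv tpermD // eq_sym.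
have [sX|] := boolP (s \in X); last first.
  by rewrite -XY => sY; apply: (misses_p_and_Y_absurd st' qX pv sY).
have [|c2 st2 mv2] := toggle st' sX rY; first by rewrite /chain_end sv'.
have tq : tperm s r q = q by rewrite tpermD ?(vq s) // eq_sym.
rewrite tq in st2; apply: (misses_p_and_Y_absurd st2 qX _ rY);
  last by rewrite mv2 tpermR.
by rewrite mv2 tpermD // eq_sym // XYneq.
Qed.

(** If both free colors are in X, one of them is first exchanged for t. *)
Lemma last_in_X_absurd c p q r s t : kstate c p q -> q \in X -> t \in Y ->
  r \in miss c v -> s \in miss c v -> s != r -> False.
Proof.
move=> st qX tY rv sv sr; have [pX pq vq] := kstate_neq st.
have [rX|] := boolP (r \in X); last first.
  by rewrite -XY => rY; apply: (misses_Y_absurd st qX rY rv sv).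
have [sX|] := boolP (s \in X); last first.
  by rewrite -XY => sY; apply: (misses_Y_absurd st qX sY sv rv); rewrite eq_sym.
have [|c' st' mv] := toggle st rX tY; first by rewrite /chain_end rv.
have tq : tperm r t q = q by rewrite tpermD ?(vq r) // eq_sym XYneq.
rewrite tq in st'; apply: (misses_Y_absurd st' qX tY (s := s)); last exact: XYneq.
- by rewrite mv tpermR.
- by rewrite mv tpermD // eq_sym // XYneq.
Qed.

(** It remains to treat q in Y.  If r is in Y, exchanging it for p makes the path
    shiftable.  If r is in X, exchanging r and q at v recolors g with r, which is in
    X, and leaves q and s free at v. *)
Lemma far_end_misses_one c p q r s t : kstate c p q -> t \in Y ->
  r \in miss c v -> s \in miss c v -> s != r -> False.
Proof.
move=> st tY rv sv sr; have [pX pq vq] := kstate_neq st.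
have [qX|] := boolP (q \in X); first exact: last_in_X_absurd st qX tY rv sv sr.
rewrite -XY => qY.
have [rp|rp] := eqVneq r p; first by apply: (shiftable_absurd st qY); rewrite -rp.
have [rX|] := boolP (r \in X); last first.
  rewrite -XY => rY; have [|c' st' mv] := toggle st pX rY.
    by rewrite /chain_end rv orbT.
  rewrite (tpermD pq (vq _ rv)) in st'.
  by apply: (shiftable_absurd st' qY); rewrite mv tpermL.
have [|c' st' mv] := toggle st rX qY; first by rewrite /chain_end rv.
rewrite tpermR in st'; apply: (last_in_X_absurd st' rX tY (s := s) (r := q)).
- by rewrite mv tpermR.
- by rewrite mv tpermD // eq_sym // vq.
- exact: vq.
Qed.

End Toggling.

End Kierstead.

(** * Degrees and deficits *)

Lemma card_miss e0 c v : all_but e0 c ->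
  #|miss c v| + degree v = k + (v \in ends e0).
Proof.
move=> [pc nc]; pose D := [set e | v \in ends e & e != e0].
have dE : degree v = (v \in ends e0) + #|D|.
  rewrite /degree (cardsD1 e0) inE; congr (_ + _).
  by apply: eq_card => e; rewrite !inE andbC.
have cD : #|~: miss c v| = #|D|.
  rewrite -(card_imset _ Some_inj).
  have -> : Some @: (~: miss c v) = c @: D.
    apply/setP => o; apply/imsetP/imsetP => [[d]|[e]].
      rewrite inE => /missPn[e ve ce] ->; exists e => //.
      by rewrite inE ve -nc ce.
    rewrite inE => /andP[ve]; rewrite -nc; case ce: (c e) => [d|] // _ ->.
    by exists d => //; rewrite inE; apply/negP => /missP/(_ e ve).
  apply: card_in_imset => e f; rewrite !inE => /andP[ve]; rewrite -nc.
  case ce: (c e) => [d|] // _ /andP[vf _] /esym; exact: pc ve vf ce.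
have := cardsC (miss c v); rewrite card_ord dE -cD; lia.
Qed.

Definition mu x z := #|[set e | ends e == [set x; z]]|.

Lemma muC x z : mu x z = mu z x.
Proof. by rewrite /mu; under eq_finset => e do rewrite setUC. Qed.

Lemma mu_gt0P x z : reflect (exists e, ends e = [set x; z]) (0 < mu x z).
Proof.
apply: (iffP card_gt0P) => -[e E]; exists e; last by rewrite inE E.
by apply/eqP; rewrite inE in E.
Qed.

Lemma mu_neq x z : 0 < mu x z -> x != z.
Proof. by case/mu_gt0P => e; apply: ends_neq. Qed.

Lemma card_linked x (P : pred (vertex G)) :
  #|[set e | [exists z, P z && (ends e == [set x; z])]]| = \sum_(z | P z) mu x z.
Proof.
under eq_bigr => z _ do rewrite /mu -sum1_card big_mkcond.
rewrite exchange_big -sum1_card big_mkcond; apply: eq_bigr => e _ /=.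
rewrite inE; case: existsP => [[z /andP[Pz /eqP Ez]]|H].
  rewrite (bigD1 z) //= inE Ez eqxx big1 ?addn0 // => u /andP[_ uz].
  rewrite inE; case: eqP => // Eu; case/eqP: uz.
  by apply: (@ends_inj e x) => //; rewrite Ez Eu.
rewrite big1 // => z Pz; rewrite inE; case: eqP => // Ez.
by case: H; exists z; rewrite Pz Ez eqxx.
Qed.

Lemma degree_mu x : degree x = \sum_z mu x z.
Proof.
rewrite -card_linked; apply: eq_card => e; rewrite !inE.
apply/idP/existsP => [/ends_other[y ->]|[z /eqP ->]]; last exact: set21.
by exists y; rewrite eqxx.
Qed.

(** * Degree conditions in critical graphs *)

Hypothesis critical : forall e, exists c, all_but e c.
Hypothesis deg_le : forall v, degree v <= k.

Definition deficit v := k - degree v.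

Lemma card_miss_in e0 c v : all_but e0 c -> v \in ends e0 ->
  #|miss c v| = (deficit v).+1.
Proof.
move=> nc ve; have := card_miss v nc; rewrite ve /deficit; have := deg_le v; lia.
Qed.

Lemma card_miss_out e0 c v : all_but e0 c -> v \notin ends e0 ->
  #|miss c v| = deficit v.
Proof.
move=> nc ve; have := card_miss v nc; rewrite (negPf ve) /deficit.
by have := deg_le v; lia.
Qed.

Lemma card_disj3 (A B D : {set C}) : [disjoint A & B] -> [disjoint A & D] ->
  [disjoint B & D] -> #|A| + #|B| + #|D| <= k.
Proof.
move=> AB AD BD; have := cardsC A; have := subset_leq_card (_ : B :|: D \subset ~: A).
rewrite card_ord cardsU (eqP (_ : B :&: D == set0)) ?setI_eq0 // cards0 subn0.
rewrite subUset -!disjoints_subset !(disjoint_sym _ A) AB AD => /(_ isT); lia.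
Qed.

Lemma uncolored_disjoint e0 c x y : all_but e0 c -> ends e0 = [set x; y] ->
  [disjoint miss c x & miss c y].
Proof.
move=> nc E; apply/pred0P => d /=; apply/negP => /andP[dx dy].
exact: uncolored_disj nc E dx dy.
Qed.

Lemma deficit_edge x y : 0 < mu x y -> deficit x + deficit y + 2 <= k.
Proof.
case/mu_gt0P => e E; have [c nc] := critical e.
have := card_disj3 (uncolored_disjoint nc E)
  (_ : [disjoint _ & set0]) (_ : [disjoint _ & set0]).
rewrite !(card_miss_in nc) ?E ?set21 ?set22 // cards0.
rewrite -!setI_eq0 !setI0 eqxx => /(_ isT isT); lia.
Qed.

Lemma fan_deficit e0 c f x y z b : all_but e0 c -> ends e0 = [set x; y] ->
  ends f = [set x; z] -> c f = Some b -> b \in miss c y ->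
  [/\ z != y, [disjoint miss c x & miss c z], [disjoint miss c y & miss c z] &
      #|miss c z| = deficit z].
Proof.
move=> nc E F cf byy.
have zy : z != y.
  apply: contraTneq byy => <-; apply/negP => /missP/(_ f).
  by rewrite F set22 => /(_ isT).
have mz : #|miss c z| = deficit z.
  apply: card_miss_out nc _; rewrite E !inE negb_or zy andbT eq_sym.
  exact: ends_neq F.
have [a ax] : exists a, a \in miss c x.
  by apply/card_gt0P; rewrite (card_miss_in nc) // E set21.
split=> //; apply/pred0P => d /=; apply/negP => /andP[d1 d2].
  exact: (fan_disj E F nc cf byy d1 d2).
exact: (fan_disj_tip E F nc cf byy ax d1 d2).
Qed.

(** Each of the d(y) + 1 colors free at y occurs at x, on an edge xz with z != y.
    The sets of colors free at x, y, z are pairwise disjoint by the fan lemmas. *)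
Lemma adjacency x y : 0 < mu x y ->
  deficit y < \sum_(z | (z != y) &&
                        (deficit x + deficit y + deficit z + 2 <= k)) mu x z.
Proof.
case/mu_gt0P => e E; have [c nc] := critical e.
have xe : x \in ends e by rewrite E set21.
have ye : y \in ends e by rewrite E set22.
rewrite -card_linked -(card_miss_in nc ye) -(card_imset _ Some_inj).
apply: leq_trans (leq_imset_card c _).
apply/subset_leq_card/subsetP => _ /imsetP[b byy ->].
have /missPn[f xf cf] : b \notin miss c x.
  by apply/negP => bx; apply: uncolored_disj nc E bx byy.
have [z F] := ends_other xf.
have [zy xz yz mz] := fan_deficit nc E F cf byy.
apply/imsetP; exists f; rewrite // inE; apply/existsP; exists z.
rewrite zy F eqxx andbT /=.
have := card_disj3 (uncolored_disjoint nc E) xz yz.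
by rewrite mz !(card_miss_in nc) //; lia.
Qed.

(** The equality says that every color is free at exactly one of x and y, which is
    the setting of [far_end_misses_one]. *)
Lemma distance_two x y w v : 0 < mu x y -> 0 < mu y w -> 0 < mu w v ->
  x != w -> x != v -> y != v -> deficit x + deficit y + 2 = k ->
  deficit v <= 1.
Proof.
case/mu_gt0P => e E; case/mu_gt0P => f F; case/mu_gt0P => g Hg xw xv yv tight.
have [c nc] := critical e; rewrite leqNgt; apply/negP.
have xe : x \in ends e by rewrite E set21.
have ye : y \in ends e by rewrite E set22.
have ve : v \notin ends e by rewrite E !inE negb_or !(eq_sym v) xv yv.
have we : w \notin ends e.
  by rewrite E !inE negb_or !(eq_sym w) xw (ends_neq F).
rewrite -(card_miss_out nc ve) => /card_gt1P[r [s [rv sv rs]]].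
have YX : miss c y = ~: miss c x.
  apply/eqP; rewrite eqEcard -disjoints_subset disjoint_sym.
  rewrite (uncolored_disjoint nc E) /=.
  have := cardsC (miss c x); rewrite card_ord !(card_miss_in nc) // => H.
  by rewrite -(leq_add2l (deficit x).+1) H; lia.
have [t ty] : exists t, t \in miss c y.
  by apply/card_gt0P; rewrite (card_miss_in nc).
have colored h : w \in ends h -> exists d, c h = Some d.
  case ch: (c h) => [d|] wh; first by exists d.
  by case: nc => _ /(_ h); rewrite ch => /esym/eqP he; rewrite -he wh in we.
have wf : w \in ends f by rewrite F set22.
have wg : w \in ends g by rewrite Hg set21.
have [[p cf] [q cg]] := (colored f wf, colored g wg).
apply: (@far_end_misses_one e f g x y w v E F Hg xw xv yv
          (miss c x) (miss c y) _ c p q s r t) => //.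
by move=> d; rewrite YX inE.
Qed.

(** Two colors are free at x, two at y, and the remaining color h is free at all
    neighbors reached by these colors.  Chains in h and a color free at x show that
    the two edges at x with colors free at y have the same other end; likewise at y.
    A last exchange identifies these two ends. *)
Lemma triangle x y : k = 5 -> 0 < mu x y -> deficit x = 1 -> deficit y = 1 ->
  (forall z, 0 < mu x z -> deficit z = 1) ->
  (forall z, 0 < mu y z -> deficit z = 1) ->
  exists u, [/\ u != x, u != y, 1 < mu x u & 1 < mu y u].
Proof.
move=> C5 /mu_gt0P[e E] dx dy dxz dyz; have [c nc] := critical e; have [pc _] := nc.
have xe : x \in ends e by rewrite E set21.
have ye : y \in ends e by rewrite E set22.
have E' : ends e = [set y; x] by rewrite setUC.
have mx := card_miss_in nc xe; have my := card_miss_in nc ye.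
rewrite dx in mx; rewrite dy in my; have xy := uncolored_disjoint nc E.
have /cards1P[h hE] : #|~: (miss c x :|: miss c y)| == 1.
  have := cardsC (miss c x :|: miss c y).
  rewrite cardsU (eqP (_ : _ :&: _ == set0)) ?setI_eq0 // card_ord cards0 mx my => K.
  by rewrite -(eqn_add2l 4) K C5.
have : h \in ~: (miss c x :|: miss c y) by rewrite hE set11.
rewrite in_setC in_setU negb_or => /andP[hx hy].
have tip u v f z b : miss c u :|: miss c v = miss c x :|: miss c y ->
    (forall z, 0 < mu u z -> deficit z = 1) -> ends e = [set u; v] ->
    ends f = [set u; z] -> c f = Some b -> b \in miss c v ->
  h \in miss c z.
  move=> UE du Ee F cf bv.
  have [zy uz vz mz] := fan_deficit nc Ee F cf bv.
  rewrite du in mz; last by apply/mu_gt0P; exists f.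
  have : miss c z \subset [set h].
    rewrite -hE -UE setCU subsetI -!disjoints_subset.
    by rewrite ![[disjoint miss c z & _]]disjoint_sym uz vz.
  by rewrite subset1 => /orP[/eqP->|/eqP K]; [rewrite set11|rewrite K cards0 in mz].
have [b1 [b2 [b1y b2y b12]]] :
    exists b1 b2, [/\ b1 \in miss c y, b2 \in miss c y & b1 != b2].
  by apply/card_gt1P; rewrite my.
have [a1 [a2 [a1x a2x a12]]] :
    exists a1 a2, [/\ a1 \in miss c x, a2 \in miss c x & a1 != a2].
  by apply/card_gt1P; rewrite mx.
have tipx b : b \in miss c y ->
    exists f z, [/\ ends f = [set x; z], c f = Some b & h \in miss c z].
  move=> bv; have /missPn[f xf cf] : b \notin miss c x.
    by apply/negP => bx; apply: uncolored_disj nc E bx bv.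
  have [z F] := ends_other xf; exists f, z; split=> //.
  exact: (tip x y f z b).
have tipy a : a \in miss c x ->
    exists f z, [/\ ends f = [set y; z], c f = Some a & h \in miss c z].
  move=> av; have /missPn[f yf cf] : a \notin miss c y.
    by apply/negP => ay; apply: uncolored_disj nc E av ay.
  have [z F] := ends_other yf; exists f, z; split=> //.
  by apply: (tip y x f z a) => //; rewrite setUC.
have [f1 [z1 [F1 cf1 hz1]]] := tipx b1 b1y; have [f2 [z2 [F2 cf2 hz2]]] := tipx b2 b2y.
have [g1 [w1 [G1 cg1 hw1]]] := tipy a1 a1x; have [g2 [w2 [G2 cg2 hw2]]] := tipy a2 a2x.
have meet (a : C) u v w : a \in miss c u -> h \in miss c v -> h \in miss c w ->
    u != v -> u != w -> connect (chain c a h) u v -> connect (chain c a h) u w -> v = w.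
  move=> au hv hw uv uw cv cw; apply/eqP/idPn => vw.
  by apply: (@chain_two_ends c a h u v w); rewrite /chain_end ?au ?hv ?hw ?orbT.
have xz1 := ends_neq F1; have xz2 := ends_neq F2.
have yw1 := ends_neq G1; have yw2 := ends_neq G2.
have lx := fan_link E F1 nc cf1 b1y.
have z12 : z1 = z2.
  apply: (meet a1 x) => //; first exact: lx.
  exact: (fan_link E F2 nc cf2 b2y a1x hz2).
have w12 : w1 = w2.
  apply: (meet b1 y) => //; first exact: (fan_link E' G1 nc cg1 a1x).
  exact: (fan_link E' G2 nc cg2 a2x).
have ha1 : h != a1 by apply: contraNneq hx => ->.
have ha2 : h != a2 by apply: contraNneq hx => ->.
have hb1 : h != b1 by apply: contraNneq hy => ->.
have ab : a1 != b1 by apply: contraTneq a1x => ->; rewrite (disjointFl xy).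
(* The chain in a1 and h from x ends at z1; exchanging a1 and h along the chain of
   w2 frees a1 at w2 while the fan x, w2 at y, which uses the color a2, survives. *)
have zw : z1 = w2.
  apply/eqP/idPn => zw; have xw : x != w2.
    apply: contraNneq hx => ->; exact: hw2.
  have nxw : connect (chain c a1 h) w2 x = false.
    apply: contraNF zw; rewrite chain_conn_sym => cw; apply/eqP.
    by apply: (meet a1 x) => //; apply: lx.
  apply: (@fan_disj_tip e g2 y x w2 a2 E' G2 (kempe c a1 h w2) b1 a1).
  - exact: kempe_all_but.
  - rewrite (kempeE _ _ _ _ (_ : w2 \in _)) ?G2 ?set22 // connect0 cg2 /=.
    by rewrite tpermD // eq_sym.
  - by rewrite kempe_miss nxw.
  - by rewrite kempe_miss; case: ifP => // _; rewrite tpermD.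
  - by rewrite kempe_miss nxw.
  - by rewrite kempe_miss connect0 tpermL.
have two u v f g a d : a != d -> c f = Some a -> c g = Some d ->
    ends f = [set u; v] -> ends g = [set u; v] -> 1 < mu u v.
  move=> ad cf cg F G0; apply/card_gt1P; exists f, g; rewrite !inE F G0 eqxx.
  split=> //; apply: contra_not_neq (elimN eqP ad) => fg.
  by move: cf; rewrite fg cg => -[].
exists z1; split; first by rewrite eq_sym.
- by rewrite zw eq_sym.
- by apply: two b12 cf1 cf2 F1 _; rewrite z12.
- by apply: two a12 cg1 cg2 _ _; rewrite ?zw // -w12.
Qed.

(** * Discharging *)

Definition spanned (A : {set vertex G}) := #|[set e | ends e \subset A]|.

Definition dense_set (A : {set vertex G}) :=
  (1 < #|A|) && (k.-1 * #|A|./2 < spanned A).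

Lemma dense_triple x y u : x != y -> y != u -> x != u -> 0 < k ->
  k <= mu x y + mu y u + mu x u -> dense_set [set x; y; u].
Proof.
move=> xy yu xu k0 K; have cA : #|[set x; y; u]| = 3.
  by rewrite setUC cardsU1 !inE cards2 xy negb_or !(eq_sym u) xu yu.
rewrite /dense_set cA muln1 prednK //; apply: leq_trans K _.
pose E v w := [set e | ends e == [set v; w]].
have EC v w : E v w = E w v by rewrite /E setUC.
have dis v s t : s != t -> E v s :&: E v t = set0.
  move=> st; apply/setP => e; rewrite !inE; apply: contraNF st.
  by case/andP => /eqP E1 /eqP E2; apply/eqP; apply: ends_inj E1 E2.
have -> : mu x y + mu y u + mu x u = #|E x y :|: E y u :|: E x u|.
  rewrite !cardsU setIUl dis // set0U (EC y u) (EC x u) dis 1?eq_sym //.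
  by rewrite (EC x y) (EC u y) dis // cards0 !subn0 (EC y x) (EC u x).
apply/subset_leq_card/subsetP => e; rewrite !inE => /orP[/orP[]|] /eqP ->;
  by apply/subsetP => v /set2P[->|->]; rewrite !inE eqxx ?orbT.
Qed.

Lemma handshake : \sum_(v : vertex G) degree v = #|edge G|.*2.
Proof.
under eq_bigr => v _ do rewrite /degree -sum1_card big_mkcond.
rewrite exchange_big -muln2 -sum_nat_const; apply: eq_bigr => e _ /=.
rewrite -(card_ends e) -sum1_card [RHS]big_mkcond.
by apply: eq_bigr => v _; rewrite inE.
Qed.

Lemma nbr_of v : 0 < degree v -> exists z, 0 < mu v z.
Proof.
rewrite degree_mu lt0n sum_nat_eq0 => /forallPn[z]; rewrite implyTb -lt0n.
by exists z.
Qed.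

Lemma mu_degree x z : mu x z <= degree x.
Proof. by rewrite degree_mu (bigD1 z) //= leq_addr. Qed.

Lemma degreeE v : degree v + deficit v = k.
Proof. by rewrite /deficit subnKC. Qed.

Hypothesis k_range : 1 < k <= 5.

(** The total demand of the low vertices on x; the truncated predecessor makes
    vertices of deficit 0 or 1 demand nothing. *)
Definition pay x := \sum_z mu x z * (deficit z).-1.

(** Let y be a neighbor of x with the largest deficit d.  By [adjacency], at least
    d + 1 of the k edges at x lead to vertices of deficit at most k - 2 - d, which
    demand nothing if d >= 2, so the demand is at most (k - 1 - d)(d - 1).  This is
    at most 2 for k <= 5, and at most 1 for k <= 4. *)
Lemma pay_le x : deficit x = 0 -> pay x <= (k == 5).+1.
Proof.
move=> dx; case: (boolP [exists y, (0 < mu x y) && (1 < deficit y)]).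
  case/existsP => y0 Py0.
  pose Q y := (0 < mu x y) && (1 < deficit y).
  case: (@arg_maxnP _ y0 Q deficit Py0) => y /andP[xy dy] ymax.
  pose P z := (z != y) && (deficit x + deficit y + deficit z + 2 <= k).
  have adj : deficit y < \sum_(z | P z) mu x z := adjacency xy.
  have pE : pay x <= (\sum_(z | ~~ P z) mu x z) * (deficit y).-1.
    rewrite /pay (bigID P) /= big1 ?add0n => [|z /andP[_ Pz]].
      rewrite big_distrl; apply: leq_sum => z _ /=.
      have [->|xz] := posnP (mu x z); first by [].
      rewrite leq_mul2l; apply/orP; right.
      have [dz|dz] := leqP (deficit z) 1; first lia.
      by have := ymax z; rewrite /Q xz dz => /(_ isT); lia.
    have -> : (deficit z).-1 = 0 by lia.
    by rewrite muln0.
  have dk := degreeE x; rewrite dx degree_mu (bigID P) /= in dk.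
  have dxy := deficit_edge xy; apply: (leq_trans pE).
  move: adj dk dxy; move: (\sum_(i | P i) _) (\sum_(i | ~~ P i) _) => s t.
  rewrite dx; move: {ymax} (deficit y) dy k_range => d dy kr; case: (eqVneq k 5); nia.
move/existsPn => none; rewrite /pay big1 // => z _; move: (none z).
rewrite negb_and -!leqNgt leqn0.
case/orP => [/eqP -> //|dz].
have -> : (deficit z).-1 = 0 by lia.
by rewrite muln0.
Qed.

Definition full_edges y := \sum_(x | deficit x == 0) mu y x.

(** If y has a neighbor x that is not full, [adjacency] at y gives more than d(x)
    edges to vertices z with d(x) + d(y) + d(z) + 2 <= k, and these z are full. *)
Lemma low_full y : 0 < degree y -> 1 < deficit y -> 1 < full_edges y.
Proof.
move=> ygt0 dy; have dk := degreeE y.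
case: (boolP [exists x, (0 < mu y x) && (0 < deficit x)]) => [/existsP[x]|none].
  case/andP => yx dx; have := deficit_edge yx.
  suff : deficit x < full_edges y by lia.
  apply: leq_trans (adjacency yx) _; rewrite /full_edges big_mkcond [leqRHS]big_mkcond.
  apply: leq_sum => z _; case: ifP => // /andP[_ H]; case: eqP => // dz; lia.
have -> : full_edges y = degree y.
  rewrite degree_mu /full_edges big_mkcond; apply: eq_bigr => x _; case: eqP => // dx.
  move/existsPn/(_ x): none.
  by rewrite [0 < deficit x]lt0n (introN eqP dx) andbT -eqn0Ngt => /eqP.
have [x yx] := nbr_of ygt0; have := deficit_edge yx; lia.
Qed.

Definition sparse :=
  \sum_(v : vertex G | 0 < degree v) degree v <=
    k.-1 * #|[set v : vertex G | 0 < degree v]|.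

(** Summing deg(v) + max(d(v) - 1, 0), which is k for a full vertex and k - 1 for
    any other non-isolated one. *)
Lemma charge_balance :
  \sum_(v : vertex G | 0 < degree v) degree v +
    \sum_(v : vertex G | 0 < degree v) (deficit v).-1 =
  k.-1 * #|[set v : vertex G | 0 < degree v]| + #|[set v | deficit v == 0]|.
Proof.
rewrite -big_split /= -!sum1_card big_distrr /= [in RHS]big_mkcond.
rewrite [X in _ + X]big_mkcond -big_split big_mkcond /=.
apply: eq_bigr => v _; rewrite !inE; have := degreeE v.
case: ifP => dv; case: eqP => D; lia.
Qed.

Lemma pay_full_edges :
  \sum_(x | deficit x == 0) pay x = \sum_z (deficit z).-1 * full_edges z.
Proof.
rewrite exchange_big; apply: eq_bigr => z _; rewrite big_distrr.
by apply: eq_bigr => x _ /=; rewrite mulnC muC.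
Qed.

Lemma full_edges_charge z : 0 < degree z ->
  (deficit z).-1 * 2 <= (deficit z).-1 * full_edges z.
Proof.
move=> dz; rewrite leq_mul2l; apply/orP.
have [dd|dd] := leqP (deficit z) 1; [left|right; exact: low_full]; lia.
Qed.

Lemma sum_full_edges_charge :
  (\sum_(v : vertex G | 0 < degree v) (deficit v).-1) * 2 <=
   \sum_z (deficit z).-1 * full_edges z.
Proof.
rewrite big_distrl big_mkcond; apply: leq_sum => z _.
by case: ifP => // /full_edges_charge.
Qed.

Lemma sum_pay_le : \sum_(x | deficit x == 0) pay x <= #|[set v | deficit v == 0]| * 2.
Proof.
rewrite -sum_nat_const big_mkcond [leqRHS]big_mkcond; apply: leq_sum => v _.
by rewrite inE; case: eqP => // /pay_le; case: (k == 5); lia.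
Qed.

(** In a sparse graph the total charge is 0, so the estimates [low_full] and [pay_le]
    used to bound it from below are equalities; this gives the following two lemmas. *)
Lemma tight_low y :
  sparse ->
  0 < degree y -> 1 < deficit y -> full_edges y <= 2.
Proof.
rewrite /sparse => H y0 dy; have := charge_balance.
have := sum_pay_le; rewrite pay_full_edges.
rewrite (bigD1 y) //= [X in _ + X = _](bigD1 y) //= => A B.
have : (\sum_(v : vertex G | (0 < degree v) && (v != y)) (deficit v).-1) * 2 <=
       \sum_(z | z != y) (deficit z).-1 * full_edges z.
  rewrite big_distrl big_mkcond [leqRHS]big_mkcond; apply: leq_sum => z _.
  by case: ifP => // /andP[/full_edges_charge ? ->].
move=> R; suff : (deficit y).-1 * full_edges y <= (deficit y).-1 * 2.
  by rewrite leq_mul2l; lia.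
by lia.
Qed.

Lemma tight_charge x :
  sparse ->
  deficit x = 0 -> pay x = 2 /\ k = 5.
Proof.
rewrite /sparse => H dx; have := charge_balance; have := sum_full_edges_charge.
rewrite -pay_full_edges.
have xin : x \in [set v | deficit v == 0] by rewrite inE dx.
rewrite [leqRHS](bigD1 x) ?dx //=.
rewrite [#|[set v | deficit v == 0]|](cardsD1 x) xin => A B.
have P : \sum_(v | (deficit v == 0) && (v != x)) pay v <=
    #|[set v | deficit v == 0] :\ x| * 2.
  rewrite -sum_nat_const big_mkcond [leqRHS]big_mkcond; apply: leq_sum => v _.
  rewrite !inE andbC; case: ifP => // /andP[_ /eqP dv].
  by have := pay_le dv; case: (k == 5); lia.
have := pay_le dx; case: eqP => k5; lia.
Qed.

Lemma tight_full u y : pay u = 2 -> 0 < mu u y ->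
  (forall v, 0 < mu u v -> v != y -> deficit v <= 1) -> mu u y * (deficit y).-1 = 2.
Proof.
rewrite /pay (bigD1 y) //= => <- uy H; rewrite [X in _ + X]big1 ?addn0 // => v vy.
have [->//|uv] := posnP (mu u v); have := H v uv vy.
by case: (deficit v) => [|[]] //; rewrite muln0.
Qed.

(** Some neighbor x of y has d(x) + d(y) = 3 = k - 2: a full one if d(y) = 3, and
    one of deficit 1 if d(y) = 2, because only two of the three edges at y lead to
    full vertices.  By [adjacency] at least
    d(y) + 1 edges of x go to full vertices u other than y, and by [distance_two]
    each such u has y as its only low neighbor.  The demand on u being 2, u and y are
    joined by 2 / (d(y) - 1) edges.  There is only room for one u, and x, y, u span at least
    6 edges. *)
Lemma low_dense y :
  sparse ->
  0 < degree y -> 1 < deficit y -> exists A, dense_set A.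
Proof.
move=> tight y0 dy; have tightE u := tight_charge tight (x := u).
have dgy := degreeE y; have fy := low_full y0 dy.
have [x0 yx0 dx0] : exists2 x0, 0 < mu y x0 & deficit x0 = 0.
  move: (ltnW fy); rewrite lt0n sum_nat_eq0 => /forallPn[x].
  by rewrite negb_imply -lt0n => /andP[/eqP dx yx]; exists x.
have [_ k5] := tightE x0 dx0; have dyx0 := deficit_edge yx0.
have fE : full_edges y = 2 by have := tight_low tight y0 dy; lia.
have [x yx dxy] : exists2 x, 0 < mu y x & deficit x + deficit y = 3.
  have [d3|d3] := eqVneq (deficit y) 3; first by exists x0; rewrite // dx0 d3.
  have : 0 < \sum_(x | deficit x != 0) mu y x.
    move: dgy; rewrite degree_mu (bigID (fun x => deficit x == 0)) /=.
    by rewrite -/(full_edges y); lia.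
  rewrite lt0n sum_nat_eq0 => /forallPn[x]; rewrite negb_imply -!lt0n => /andP[dx yx].
  exists x => //; have := deficit_edge yx; lia.
have xy : 0 < mu x y by rewrite muC.
pose P u := (u != y) && (deficit u == 0).
have adj : deficit y < \sum_(u | P u) mu x u.
  apply: leq_trans (adjacency xy) _; rewrite big_mkcond [leqRHS]big_mkcond.
  apply: leq_sum => u _; rewrite /P; case: ifP => // /andP[-> H] /=.
  by case: eqP => // du; lia.
have uP u : P u -> 0 < mu x u -> mu u y * (deficit y).-1 = 2.
  case/andP => uy /eqP du xu; have [pu _] := tightE u du.
  have uyx v : 0 < mu u v -> v != y -> deficit v <= 1.
    move=> uv vy; have [vx|vx] := eqVneq v x; first by rewrite vx; lia.
    apply: (distance_two yx xu uv); rewrite 1?eq_sym //; lia.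
  apply: (tight_full pu _ uyx); rewrite lt0n; apply/eqP => uy0.
  have : 0 < pay u by rewrite pu.
  rewrite lt0n sum_nat_eq0 => /forallPn[v].
  rewrite implyTb -lt0n muln_gt0 => /andP[uv dv].
  have [vy|vy] := eqVneq v y; first by rewrite vy uy0 in uv.
  by have := uyx v uv vy; lia.
have [u Pu xu] : exists2 u, P u & 0 < mu x u.
  move: (leq_ltn_trans (leq0n _) adj); rewrite lt0n sum_nat_eq0 => /forallPn[u].
  by rewrite negb_imply -lt0n => /andP[Pu xu]; exists u.
have uE := uP u Pu xu; have yx_neq := mu_neq yx; have xu_neq := mu_neq xu.
have uniq_u w : P w -> w != u -> mu x w = 0.
  move=> Pw wu; apply/eqP; rewrite -leqn0 leqNgt; apply/negP => xw.
  have wE := uP w Pw xw; have xw_neq := mu_neq xw.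
  move: dgy; rewrite degree_mu (bigD1 x) //= (bigD1 u) /= 1?eq_sym //.
  rewrite (bigD1 w) /=; last by rewrite wu eq_sym xw_neq.
  rewrite (muC y u) (muC y w); move: uE wE; rewrite k5.
  move: (mu u y) (mu w y) (mu y x) (deficit y) dy yx dxy {adj dyx0}.
  by move=> m n p [|[|[|d]]] // *; lia.
exists [set x; y; u]; case/andP: (Pu) => uy _; apply: dense_triple => //.
- exact: mu_neq.
- by rewrite eq_sym.
- by rewrite k5.
have : \sum_(u | P u) mu x u = mu x u.
    by rewrite (bigD1 u) //= big1 ?addn0 // => w /andP[]; exact: uniq_u.
  move: adj => /[swap] -> adj; have : 0 < mu u y by case: (mu u y) uE.
  by rewrite k5 (muC y u); lia.
Qed.

Theorem critical_dense : 0 < #|edge G| -> exists A, dense_set A.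
Proof.
case/card_gt0P => e _.
have [|tight] := ltnP (k.-1 * #|[set v : vertex G | 0 < degree v]|)
                     (\sum_(v : vertex G | 0 < degree v) degree v).
  set S := [set v | _] => H.
  have sub f : ends f \subset S.
    apply/subsetP => v vf; rewrite inE /degree; apply/card_gt0P; exists f.
    by rewrite inE.
  exists S; apply/andP; split.
    by rewrite -(card_ends e) subset_leq_card.
  have -> : spanned S = #|edge G|.
    by rewrite /spanned -cardsT; apply: eq_card => f; rewrite !inE sub.
  have : \sum_(v : vertex G | 0 < degree v) degree v = #|edge G|.*2.
    rewrite -handshake big_mkcond; apply: eq_bigr => v _.
    by case: (degree v).
  by move: H => /[swap] -> H; have := odd_double_half #|S|; nia.
case: (boolP [exists y, (0 < degree y) && (1 < deficit y)]) => [/existsP[y /andP[]]|].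
  exact: low_dense.
move=> /existsPn nolow.
have pos u v : 0 < mu u v -> 0 < degree v.
  by rewrite muC => /leq_trans; apply; apply: mu_degree.
have le1 v : 0 < degree v -> deficit v <= 1.
  by move=> v0; have := nolow v; rewrite v0 /= -leqNgt.
have one v : 0 < degree v -> deficit v = 1.
  move=> v0; have := le1 v v0; rewrite leq_eqVlt ltnS leqn0 => /predU1P[//|/eqP dv].
  have [pv _] := tight_charge tight dv; move: pv; rewrite /pay big1 // => z _.
  have [->//|vz] := posnP (mu v z); have := le1 z (pos _ _ vz).
  by case: (deficit z) => [|[]] //; rewrite muln0.
have [x xe] : exists x, x \in ends e by apply/card_gt0P; rewrite card_ends.
have [y E] := ends_other xe; have xy : 0 < mu x y by apply/mu_gt0P; exists e.
have yx : 0 < mu y x by rewrite muC.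
have dx := one x (pos _ _ yx); have dy := one y (pos _ _ xy).
have k5 : k = 5.
  have := leq_ltn_trans (leq0n _) (adjacency xy).
  rewrite lt0n sum_nat_eq0 => /forallPn[z].
  rewrite negb_imply -lt0n => /andP[/andP[_ H] xz].
  by move: H; rewrite dx dy (one z (pos _ _ xz)); lia.
have [||u [ux uy xu yu]] := triangle k5 xy dx dy.
- by move=> z xz; apply: one (pos _ _ xz).
- by move=> z xz; apply: one (pos _ _ xz).
exists [set x; y; u]; apply: dense_triple; rewrite ?k5 // 1?eq_sym //.
  by rewrite eq_sym; apply: mu_neq.
by lia.
Qed.

End Colorings.

(** * From a graph to a critical subgraph *)

Section Reduction.

Variables (G : multigraph) (k : nat).

Definition colorable (F : {set edge G}) :=
  [exists c : {ffun edge G -> 'I_k}, [forall e in F, [forall f in F,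
     (e != f) && (c e == c f) ==> [disjoint ends e & ends f]]]].

Lemma colorableP (F : {set edge G}) :
  reflect (exists c : edge G -> 'I_k, {in F &, forall e f v,
             v \in ends e -> v \in ends f -> c e = c f -> e = f})
          (colorable F).
Proof.
apply: (iffP existsP) => -[c H].
  exists c => e f eF fF v ve vf cef; apply/eqP/idPn => ef.
  move/forall_inP/(_ e eF)/forall_inP/(_ f fF): H; rewrite ef cef eqxx /=.
  by move/disjointFr/(_ ve); rewrite vf.
exists (finfun c); apply/forall_inP => e eF; apply/forall_inP => f fF.
apply/implyP; rewrite !ffunE => /andP[ef /eqP cef]; apply/pred0P => v /=.
by apply: contraNF ef => /andP[ve vf]; apply/eqP; apply: (H e f _ _ v).
Qed.

Lemma chromatic_index_le : colorable [set: edge G] -> chromatic_index G <= k.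
Proof.
case/colorableP => c pc; pose P := preim_partition c [set: edge G].
have partP : partition P [set: edge G] := preim_partitionP _ _.
have cardP : #|P| <= k.
  rewrite /P /preim_partition /equivalence_partition /=.
  rewrite (imset_comp (fun i => [set f in [set: edge G] | i == c f]) c).
  apply: leq_trans (leq_imset_card _ _) _.
  by rewrite -[leqRHS]card_ord max_card.
apply: leq_trans cardP; rewrite /chromatic_index; case: ex_minnP => m _; apply.
apply/existsP; exists P; rewrite partP eqxx /=.
apply/forall_inP => M /imsetP[e0 _ ->].
apply/forall_inP => e; rewrite !inE /= => /eqP ce.
apply/forall_inP => f; rewrite !inE /= => /eqP cf; apply/implyP => ef.
apply/pred0P => v /=; apply: contraNF ef => /andP[ve vf]; apply/eqP.
by apply: (pc e f _ _ v); rewrite ?inE // -ce.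
Qed.

Definition edge_sub (F : {set edge G}) : multigraph :=
  @Multigraph (vertex G) {e | e \in F} (fun e => ends (val e))
    (fun e => card_ends (val e)).

Lemma edge_sub_uncolorable (F : {set edge G}) : 0 < k -> ~~ colorable F ->
  forall c : edge (edge_sub F) -> option 'I_k, proper c -> exists e, c e = None.
Proof.
move=> k0 nF c pc; case: (boolP [exists e, c e == None]) => [/existsP[e /eqP]|none].
  by exists e.
case/negP: nF; apply/colorableP.
have total e : exists d, c e = Some d.
  by move/existsPn/(_ e): none; case: (c e) => // d _; exists d.
exists (fun e => odflt (Ordinal k0) (obind c (insub e))) => e f eF fF v ve vf.
rewrite !insubT /=; have [d ce] := total (Sub e eF); have [d' cf] := total (Sub f fF).
rewrite ce cf /= => dd; rewrite -dd in cf.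
by have /(congr1 val) := pc (Sub e eF) (Sub f fF) v d ve vf ce cf.
Qed.

Lemma edge_sub_critical (F : {set edge G}) : minset (fun F => ~~ colorable F) F ->
  forall e : edge (edge_sub F),
    exists c : edge (edge_sub F) -> option 'I_k, all_but e c.
Proof.
move=> /minsetP[_ minF] e.
have /colorableP[c pc] : colorable (F :\ val e).
  rewrite -[colorable _]negbK; apply/negP => /minF/(_ (subD1set _ _)) FE.
  by move/setP/(_ (val e)): FE; rewrite setD11 (valP e).
exists (fun f => if f == e then None else Some (c (val f))); split=> [f g v d|f].
  case: eqP => // /eqP fe; case: eqP => // /eqP ge vf vg [cf] [cg].
  apply/val_inj/(pc _ _ _ _ v); rewrite ?cf // !inE (inj_eq val_inj) ?fe ?ge;
    exact: valP.
by case: (f == e).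
Qed.

Lemma edge_sub_degree (F : {set edge G}) v :
  degree (v : vertex (edge_sub F)) <= degree (v : vertex G).
Proof.
rewrite /degree -(card_imset _ (@val_inj _ _ {e | e \in F})).
by apply/subset_leq_card/subsetP => _ /imsetP[e + ->]; rewrite !inE.
Qed.

Lemma dense_density (F : {set edge G}) (A : {set vertex G}) : 0 < k ->
  dense_set k (A : {set vertex (edge_sub F)}) -> k <= density G.
Proof.
move=> k0 /andP[A1 dA]; pose H := (A, [set e | ends e \subset A]).
have sH : subgraph H && (2 <= #|H.1|).
  by rewrite A1 andbT; apply/forall_inP => e; rewrite inE.
rewrite /density; apply: leq_trans (leq_bigmax_cond H sH).
rewrite -(prednK k0) ltnNge ceil_div_le /=; last by rewrite half_gt0.
rewrite -ltnNge; apply: leq_trans dA _.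
rewrite /spanned -(card_imset _ (@val_inj _ _ {e | e \in F})).
by apply/subset_leq_card/subsetP => _ /imsetP[e + ->]; rewrite !inE.
Qed.

End Reduction.

Theorem mainTheorem3 (G : multigraph)
    (hDelta : max_degree G \in [:: 2; 3; 4; 5])
    (hchi : max_degree G + 1 <= chromatic_index G) :
  max_degree G <= density G.
Proof.
have kr : 1 < max_degree G <= 5 by move: hDelta; rewrite !inE; lia.
have k0 : 0 < max_degree G by lia.
have nG : ~~ colorable (max_degree G) [set: edge G].
  by apply/negP => /chromatic_index_le; lia.
have [F minF _] := minset_exists (P := fun F => ~~ colorable (max_degree G) F) nG.
have nF := minsetp minF.
have [|||A dA] := @critical_dense (edge_sub F) (max_degree G)
  (edge_sub_uncolorable k0 nF) (edge_sub_critical minF).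
- move=> v; apply: leq_trans (edge_sub_degree v) _.
  exact: (leq_bigmax (F := @degree G)).
- exact: kr.
- rewrite /= card_sig (eq_card (_ : _ =i F)) // card_gt0.
  apply: contraNneq nF => ->; apply/colorableP.
  by exists (fun=> Ordinal k0) => e f; rewrite inE.
- exact: dense_density k0 dA.
Qed.
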